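(* Let $N\ge 1$ be an integer, $z\in\mathbb{R}^d$, let $f:\mathbb{R}^d\to\mathbb{R}^d$ be $C^{N-1}$ in a neighbourhood of $z$, and let $w:\mathbb{T}\to\mathbb{R}^d$ (a fixed noise sample path) be $C^{N-1}$ in a neighbourhood of $0$, where $\mathbb{T}\subset\mathbb{R}$ is an open interval containing $0$; if $N=1$ assume in addition that $f$ is locally Lipschitz. Let $\mathrm{x}_0^{(0)}=z$ and recursively $$\mathrm{x}_0^{(n+1)}=\mathrm{f}^{(n)}\big(\mathrm{x}_0^{(0)},\dots,\mathrm{x}_0^{(n)}\big)+\frac{d^n}{dt^n}w_t\Big|_{t=0},\qquad 0\le n\le N-1,$$ and let $x$ be the unique solution of $\frac{d}{dt}x_t=f(x_t)+w_t$, $x_0=z$, near $t=0$. Then there is $\varepsilon>0$ such that for all $t\in(-\varepsilon,\varepsilon)$ $$\sum_{n=0}^N\mathrm{x}_0^{(n)}\frac{t^n}{n!}=\sum_{n=0}^N\frac{d^n}{dt^n}x_t\Big|_{t=0}\frac{t^n}{n!}=x_t+o(|t|^N),$$ where the remainder is understood as $t\to0$.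
   Context: The functions $\mathrm{f}^{(n)}:(\mathbb{R}^d)^{n+1}\to\mathbb{R}^d$, $0\le n\le N-1$ (components of the generalised flow), are the expressions obtained from the chain rule such that $\mathrm{f}^{(n)}\big(x_t,\frac{d}{dt}x_t,\dots,\frac{d^n}{dt^n}x_t\big)=\frac{d^n}{dt^n}f(x_t)$; equivalently $\mathrm{f}^{(n)}(z^{(0)},\dots,z^{(n)})=\frac{d^n}{ds^n}\big|_{s=0} f\big(\sum_{k=0}^n z^{(k)}s^k/k!\big)$ (for $z^{(0)}$ in the neighbourhood where $f$ is $C^{N-1}$). The polynomial $\mathrm{x}^{(0)}_t=\sum_{n=0}^N\mathrm{x}^{(n)}_0t^n/n!$ is the zeroth-order component of the solution of the generalised-coordinate system of order $N$. *)

(* Defs.v *)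
From HB Require Import structures.
From mathcomp Require Import all_boot all_order all_algebra.
From mathcomp Require Import all_classical all_reals all_analysis.

Set Implicit Arguments.
Unset Strict Implicit.
Unset Printing Implicit Defensive.

Import Order.TTheory GRing.Theory Num.Theory.
Import numFieldNormedType.Exports.

Local Open Scope classical_set_scope.
Local Open Scope ring_scope.

(* C^k maps on an open set [U] of R^d: C^(k+1) means Fréchet differentiable
   with a differential of class C^k.  The space of linear maps on R^d being
   finite-dimensional, the latter amounts to [x |-> 'd g x v = 'D_v g x] being
   C^k for every fixed direction [v]. *)
Fixpoint Ck_on (R : realType) (d m k : nat) (U : set 'rV[R]_d)
    (g : 'rV[R]_d -> 'rV[R]_m) : Prop :=
  match k with
  | 0 => forall x, U x -> {for x, continuous g}
  | k'.+1 => (forall x, U x -> differentiable g x) /\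
             (forall v : 'rV[R]_d, Ck_on k' U ('D_v g))
  end.

Definition Ck_near (R : realType) (d m k : nat) (p : 'rV[R]_d)
    (g : 'rV[R]_d -> 'rV[R]_m) : Prop :=
  exists U : set 'rV[R]_d, open_nbhs p U /\ Ck_on k U g.

Definition Ck_path_on (R : realType) (m k : nat) (U : set R)
    (w : R -> 'rV[R]_m) : Prop :=
  (forall n t, (n < k)%N -> U t -> derivable (derive1n n w) t 1) /\
  (forall t, U t -> {for t, continuous (derive1n k w)}).

Definition locally_lipschitz (R : realType) (d m : nat)
    (g : 'rV[R]_d -> 'rV[R]_m) : Prop :=
  forall p : 'rV[R]_d,
    exists U : set 'rV[R]_d, open_nbhs p U /\ exists L : R, L.-lipschitz_U g.

(* The polynomial path \sum_(k <= n) z^(k) t^k / k! with derivatives z^(k)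
   at t = 0. *)
Definition jet_path (R : realType) (d n : nat) (z : 'I_n.+1 -> 'rV[R]_d)
    (t : R) : 'rV[R]_d :=
  \sum_(k < n.+1) (t ^+ k / k`!%:R) *: z k.

(* Component f^(n) : (R^d)^(n+1) -> R^d of the generalised flow of [f]. *)
Definition gen_flow (R : realType) (d : nat) (f : 'rV[R]_d -> 'rV[R]_d)
    (n : nat) (z : 'I_n.+1 -> 'rV[R]_d) : 'rV[R]_d :=
  derive1n n (fun s : R => f (jet_path z s)) 0.

(* Main.v *)
Require Import Defs.
From HB Require Import structures.
From mathcomp Require Import all_boot all_order all_algebra.
From mathcomp Require Import all_classical all_reals all_analysis.
From mathcomp Require Import zify.

Set Implicit Arguments.
Unset Strict Implicit.
Unset Printing Implicit Defensive.

Import Order.TTheory GRing.Theory Num.Theory.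
Import numFieldNormedType.Exports.

Local Open Scope classical_set_scope.
Local Open Scope ring_scope.

(** The solution [x] and the polynomial built from the recursion have the same
    derivatives at 0 up to order N; the remainder estimate is then Taylor's
    theorem with Peano remainder.

    The derivatives are compared through the relation [eq_jet n g h]: near 0
    both paths are n times derivable, and at 0 their derivatives up to order n
    coincide.  It is defined by recursion on n through the first derivative,
    so that the induction on n never needs a formula for higher derivatives
    (Leibniz or Faa di Bruno).  The key fact is [eq_jet_comp]: composition with
    a map [f] of class C^n preserves the relation, because
    (f o g)' = \sum_i g'_i *: ('D_(e_i) f o g), where each partial derivative
    is of class C^(n-1) and the induction hypothesis applies.

    With it the theorem is an induction on the order.  If [x] agrees to order n
    with the Taylor polynomial J_n of coefficients x0 0, ..., x0 n, then
    x' = f(x) + w is n times derivable near 0 and its n-th derivative at 0 is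
    that of f(J_n) + w, which is the generalised flow plus the n-th derivative
    of the noise, that is, x0 n.+1.  So [x] agrees with J_(n+1) to order n+1.
    At order N, [eq_jet_littleo] gives the remainder o(|t|^N): the mean value
    theorem, applied to each coordinate, raises an estimate on the derivative
    by one order. *)

(** * Derivatives of vector-valued paths *)

Lemma is_derive_mx (R : realType) (m n : nat) (M : R -> 'M[R]_(m, n)) (t : R)
    (D : 'M[R]_(m, n)) :
  is_derive t (1 : R) M D <->
  forall i j, is_derive t (1 : R) (fun s => M s i j : R) (D i j).
Proof.
split=> [[Mt <-] i j|h].
  by apply: DeriveDef; [move/derivable_mxP : Mt|rewrite derive_mx// mxE].
have Mt : derivable M t 1 by apply/derivable_mxP => i j; case: (h i j).
apply: DeriveDef => //; rewrite derive_mx//.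
by apply/matrixP => i j; rewrite mxE; case: (h i j).
Qed.

Lemma is_derive_scale (R : realType) (m : nat) (a : R -> R)
    (u : R -> 'rV[R]_m) (t da : R) (du : 'rV[R]_m) :
  is_derive t (1 : R) a da -> is_derive t 1 u du ->
  is_derive t (1 : R) (fun s => a s *: u s) (da *: u t + a t *: du).
Proof.
move=> aD /is_derive_mx uD; apply/is_derive_mx => i j.
have := is_deriveM aD (uD i j).
have -> : (fun s => (a s *: u s) i j) = a * (fun s => u s i j).
  by apply/funext => s; rewrite mxE.
by move=> /is_derive_eq; apply; rewrite !mxE addrC [X in _ + X]mulrC.
Qed.

(** Chain rule along a path, expanded on the canonical basis so that only
    partial derivatives of [f] along fixed directions occur: those are the
    maps that [Ck_on] controls. *)
Lemma is_derive_comp (R : realType) (d m : nat) (f : 'rV[R]_d -> 'rV[R]_m)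
    (g : R -> 'rV[R]_d) (t : R) (dg : 'rV[R]_d) :
  is_derive t (1 : R) g dg -> differentiable f (g t) ->
  is_derive t (1 : R) (fun s => f (g s))
    (\sum_(i < d) dg 0 i *: 'D_('e_i) f (g t)).
Proof.
move=> [gt <-] fgt.
have gdiff : differentiable g t by apply/derivable1_diffP.
have cdiff : differentiable (f \o g) t by exact: differentiable_comp.
apply: DeriveDef; first by apply/derivable1_diffP.
rewrite [LHS](deriveE _ cdiff) diff_comp//= -(deriveE _ gdiff).
rewrite [X in 'd f _ X]row_sum_delta linear_sum/=; apply: eq_bigr => i _.
by rewrite linearZ/= (deriveE _ fgt).
Qed.

(** * Paths with the same jet at 0 *)

(** The derivatives are only asked to exist near 0 and are quantified rather
    than written with [derive1]: the relation then depends on the germs of the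
    paths alone, and the closure properties below follow by exhibiting the
    derivatives.  On the diagonal, [eq_jet n g g] says that [g] is n times
    derivable near 0. *)
Fixpoint eq_jet (R : realType) (V : normedModType R) (n : nat)
    (g h : R -> V) : Prop :=
  g 0 = h 0 /\
  if n is n'.+1 then
    exists g' h' : R -> V,
      [/\ \forall t \near (0 : R), is_derive t (1 : R) g (g' t),
          \forall t \near (0 : R), is_derive t (1 : R) h (h' t) &
          eq_jet n' g' h']
  else True.

Lemma eq_jet_le (R : realType) (V : normedModType R) k n (g h : R -> V) :
  (k <= n)%N -> eq_jet n g h -> eq_jet k g h.
Proof.
elim: k n g h => [|k IH] [|n] g h//=; first by move=> _ [].
rewrite ltnS => kn [e [g' [h' [gD hD j]]]]; split=> //; exists g', h'.
by split=> //; exact: IH j.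
Qed.

Lemma eq_jetl (R : realType) (V : normedModType R) n (g h : R -> V) :
  eq_jet n g h -> eq_jet n g g.
Proof.
elim: n g h => [|n IH] g h//= [_ [g' [h' [gD _ j]]]]; split=> //.
by exists g', g'; split=> //; exact: IH j.
Qed.

Lemma eq_jetD (R : realType) (V : normedModType R) n (g h g1 h1 : R -> V) :
  eq_jet n g h -> eq_jet n g1 h1 ->
  eq_jet n (fun t => g t + g1 t) (fun t => h t + h1 t).
Proof.
elim: n g h g1 h1 => [|n IH] g h g1 h1 /= [e D] [e1 D1]; split=> //;
  rewrite ?e ?e1//.
have [g' [h' [gD hD j]]] := D; have [g1' [h1' [g1D h1D j1]]] := D1.
exists (fun t => g' t + g1' t), (fun t => h' t + h1' t); split; last exact: IH.
- by apply: filterS2 gD g1D => t gt g1t; exact: is_deriveD.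
- by apply: filterS2 hD h1D => t ht h1t; exact: is_deriveD.
Qed.

Lemma eq_jet_cst (R : realType) (V : normedModType R) n (v : V) :
  eq_jet n (fun=> v : V) (fun=> v).
Proof.
elim: n v => [|n IH] v; split=> //; exists (fun=> 0), (fun=> 0).
have D : \forall t \near (0 : R), is_derive t (1 : R) (fun=> v) 0.
  by near=> t; exact: is_derive_cst.
by split=> //; exact: IH.
Unshelve. all: by end_near.
Qed.

Lemma eq_jet_sum (R : realType) (V : normedModType R) n (I : Type)
    (s : seq I) (g h : I -> R -> V) :
  (forall i, eq_jet n (g i) (h i)) ->
  eq_jet n (fun t => \sum_(i <- s) g i t) (fun t => \sum_(i <- s) h i t).
Proof.
move=> gh; elim: s => [|i s IH].
  by under eq_fun do rewrite big_nil; under [X in eq_jet n _ X]eq_fun do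
    rewrite big_nil; exact: eq_jet_cst.
under eq_fun do rewrite big_cons.
under [X in eq_jet n _ X]eq_fun do rewrite big_cons.
exact: eq_jetD.
Qed.

Lemma eq_jet_scale (R : realType) (m n : nat) (a b : R -> R)
    (u v : R -> 'rV[R]_m) :
  eq_jet n a b -> eq_jet n u v ->
  eq_jet n (fun t => a t *: u t) (fun t => b t *: v t).
Proof.
elim: n a b u v => [|n IH] a b u v; first by move=> /= [-> _] [-> _].
move=> ab uv; have abn := eq_jet_le (leqnSn n) ab.
have uvn := eq_jet_le (leqnSn n) uv.
move: ab uv => /= [-> [a' [b' [aD bD ab']]]] [-> [u' [v' [uD vD uv']]]].
split=> //; exists (fun t => a' t *: u t + a t *: u' t),
  (fun t => b' t *: v t + b t *: v' t); split.
- by apply: filterS2 aD uD => t; exact: is_derive_scale.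
- by apply: filterS2 bD vD => t; exact: is_derive_scale.
- by apply: eq_jetD; exact: IH.
Qed.

Lemma eq_jet_coord (R : realType) (m n : nat) (u v : R -> 'rV[R]_m) i :
  eq_jet n u v -> eq_jet n (fun t => u t 0 i : R) (fun t => v t 0 i).
Proof.
elim: n u v => [|n IH] u v /=; first by move=> [-> _].
move=> [-> [u' [v' [uD vD uv']]]]; split=> //.
exists (fun t => u' t 0 i), (fun t => v' t 0 i); split; last exact: IH.
- by apply: filterS uD => t /is_derive_mx.
- by apply: filterS vD => t /is_derive_mx.
Qed.

(** * Composition with a map of class C^n *)

Lemma Ck_on_le (R : realType) (d m k n : nat) (U : set 'rV[R]_d)
    (f : 'rV[R]_d -> 'rV[R]_m) : (k <= n)%N -> Ck_on n U f -> Ck_on k U f.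
Proof.
elim: k n f => [|k IH] [|n] f//=.
  by move=> _ [fU _] x /fU; exact: differentiable_continuous.
by rewrite ltnS => kn [fU fk]; split=> // v; exact: IH (fk v).
Qed.

(** A path derivable at 0 is continuous there, hence stays near 0 in the open
    set on which [f] is differentiable. *)
Lemma near_comp_differentiable (R : realType) (d m : nat) (U : set 'rV[R]_d)
    (f : 'rV[R]_d -> 'rV[R]_m) (g g' : R -> 'rV[R]_d) :
  open_nbhs (g 0) U -> (forall x, U x -> differentiable f x) ->
  (\forall t \near (0 : R), is_derive t (1 : R) g (g' t)) ->
  \forall t \near (0 : R), is_derive t (1 : R) (fun s => f (g s))
    (\sum_(i < d) g' t 0 i *: 'D_('e_i) f (g t)).
Proof.
move=> /open_nbhs_nbhs Ug fU gD.
have [gD0 _] := nbhs_singleton gD.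
have /derivable1_diffP/differentiable_continuous gc := gD0.
apply: filterS2 gD (gc _ Ug) => t gt /fU; exact: is_derive_comp.
Qed.

(** By [near_comp_differentiable] the derivative of [f o g] is a sum of products
    of a coordinate of [g'] with a partial derivative of [f] along [g]; the
    latter is again a composition, with a map of one class less, so induction
    on [n] applies, for all [f] at once. *)
Lemma eq_jet_comp (R : realType) (d m n : nat) (f : 'rV[R]_d -> 'rV[R]_m)
    (g h : R -> 'rV[R]_d) :
  Ck_near n (g 0) f -> eq_jet n g h ->
  eq_jet n (fun t => f (g t)) (fun t => f (h t)).
Proof.
elim: n f g h => [|n IH] f g h; first by move=> _ /= [-> _].
move=> [U [Ug [fU fC]]] gh; have ghn := eq_jet_le (leqnSn n) gh.
move: gh => /= [e [g' [h' [gD hD gh']]]]; split; first by rewrite e.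
exists (fun t => \sum_(i < d) g' t 0 i *: 'D_('e_i) f (g t)),
  (fun t => \sum_(i < d) h' t 0 i *: 'D_('e_i) f (h t)); split.
- apply: (near_comp_differentiable Ug fU gD).
- by apply: (@near_comp_differentiable _ _ _ U) hD => //; rewrite -e.
- apply: eq_jet_sum => i; apply: eq_jet_scale; first exact: eq_jet_coord.
  by apply: (IH ('D_('e_i) f) g h) => //; exists U; split=> //; exact: fC.
Qed.

(** * Jets and iterated derivatives *)

Lemma near_eq_derive1n (R : realType) (V : normedModType R) n (g h : R -> V)
    (a : R) :
  {near a, g =1 h} -> {near a, derive1n n g =1 derive1n n h}.
Proof.
elim: n g h => [|n IH] g h gh//; rewrite !derive1Sn; apply: IH.
apply: filterS (near_join gh) => t gt; rewrite !derive1E.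
by apply: near_eq_derive.
Qed.

(** Links the quantified derivative in [eq_jet] to [derive1n]: a path [g']
    that is the derivative of [g] only near [a] still computes all higher
    derivatives of [g] near [a]. *)
Lemma near_derive1nS (R : realType) (V : normedModType R) n (g g' : R -> V)
    (a : R) :
  (\forall t \near a, is_derive t (1 : R) g (g' t)) ->
  {near a, derive1n n.+1 g =1 derive1n n g'}.
Proof.
move=> gD; rewrite derive1Sn; apply: near_eq_derive1n.
by apply: filterS gD => t [_ <-]; rewrite derive1E.
Qed.

Lemma eq_jet_derive1n (R : realType) (V : normedModType R) n (g h : R -> V) :
  eq_jet n g h -> derive1n n g 0 = derive1n n h 0.
Proof.
elim: n g h => [|n IH] g h /=; first by case.
move=> [_ [g' [h' [gD hD /IH]]]].
rewrite -(nbhs_singleton (near_derive1nS n gD)).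
by rewrite -(nbhs_singleton (near_derive1nS n hD)).
Qed.

Lemma eq_jet_derivable (R : realType) (V : normedModType R) n (g h : R -> V) :
  eq_jet n g h ->
  \forall t \near (0 : R), forall k, (k < n)%N -> derivable (derive1n k g) t 1.
Proof.
elim: n g h => [|n IH] g h /=; first by move=> _; near=> t => k; rewrite ltn0.
move=> [_ [g' [h' [gD hD /IH gn]]]].
apply: filterS2 (near_join gD) gn => t gDt gnt [_|k].
  by have [] := nbhs_singleton gDt.
rewrite ltnS => /gnt; apply: near_eq_derivable.
by apply: filterS (near_derive1nS k gDt) => s ->.
Unshelve. all: by end_near. Qed.

Lemma derivable_eq_jet (R : realType) (V : normedModType R) n (g : R -> V) :
  (\forall t \near (0 : R), forall k, (k < n)%N ->
     derivable (derive1n k g) t 1) ->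
  eq_jet n g g.
Proof.
elim: n g => [|n IH] g gn; split=> //; exists (derive1 g), (derive1 g).
have gD : \forall t \near (0 : R), is_derive t (1 : R) g (derive1 g t).
  by apply: filterS gn => t /(_ 0%N isT) gt; rewrite derive1E; exact: derivableP.
split=> //; apply: IH; apply: filterS gn => t gt k kn.
by rewrite -derive1Sn; exact: gt.
Qed.

Lemma derive1nD (R : realType) (V : normedModType R) n (g h : R -> V) :
  eq_jet n g g -> eq_jet n h h ->
  derive1n n (fun t => g t + h t) 0 = derive1n n g 0 + derive1n n h 0.
Proof.
elim: n g h => [|n IH] g h // [_ [g' [g1 [gD _ /eq_jetl gg]]]].
move=> [_ [h' [h1 [hD _ /eq_jetl hh]]]].
have ghD : \forall t \near (0 : R),
    is_derive t (1 : R) (fun s => g s + h s) (g' t + h' t).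
  by apply: filterS2 gD hD => t gt ht; exact: is_deriveD.
rewrite (nbhs_singleton (near_derive1nS n gD)).
rewrite (nbhs_singleton (near_derive1nS n hD)).
by rewrite (nbhs_singleton (near_derive1nS n ghD)) IH.
Qed.

(** Differentiating a Taylor polynomial shifts its coefficients: the constant
    term disappears and t^(k+1)/(k+1)! becomes t^k/k!. *)
Lemma is_derive_jet_path (R : realType) (d n : nat) (u : nat -> 'rV[R]_d) t :
  is_derive t (1 : R) (jet_path (fun k : 'I_n.+2 => u k))
    (jet_path (fun k : 'I_n.+1 => u k.+1) t).
Proof.
have -> : jet_path (fun k : 'I_n.+2 => u k) = cst (u 0%N) +
    \sum_(k < n.+1) (fun s => (s ^+ k.+1 / k.+1`!%:R) *: u k.+1).
  apply/funext => s; rewrite /jet_path big_ord_recl/= expr0 fact0 divr1 scale1r.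
  by rewrite -[RHS]/(u 0%N + _) fct_sumE.
rewrite -[X in is_derive _ _ _ X]add0r; apply: is_deriveD.
rewrite /jet_path; apply: is_derive_sum => k.
have := @is_derive_scale R d (fun s => s ^+ k.+1 / k.+1`!%:R)
  (fun=> u k.+1) t (t ^+ k / k`!%:R) 0.
rewrite scaler0 addr0; apply.
have -> : (fun s : R => s ^+ k.+1 / k.+1`!%:R) = k.+1`!%:R^-1 \*: (id ^+ k.+1).
  by apply/funext => s; rewrite /= exprfctE mulrC.
apply: (is_derive_eq (is_deriveZ _ (is_deriveX k.+1 (is_derive_id t 1)))).
rewrite /= [_ *: 1]mulr1 factS natrM invfM /GRing.scale/=.
by rewrite mulrACA mulVf ?mul1r 1?mulrC// pnatr_eq0.
Qed.

Lemma eq_jet_jet_path (R : realType) (d n : nat) (g : R -> 'rV[R]_d)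
    (u : nat -> 'rV[R]_d) :
  eq_jet n g g -> (forall k, (k <= n)%N -> derive1n k g 0 = u k) ->
  eq_jet n g (jet_path (fun k : 'I_n.+1 => u k)).
Proof.
have jet0 m (v : nat -> 'rV[R]_d) : jet_path (fun k : 'I_m.+1 => v k) 0 = v 0%N.
  rewrite /jet_path big_ord_recl expr0 fact0 divr1 scale1r big1 ?addr0// => i _.
  by rewrite expr0n mul0r scale0r.
elim: n g u => [|n IH] g u /=; first by move=> _ gu; rewrite jet0 -(gu 0%N).
move=> [_ [g' [h' [gD _ /eq_jetl gg]]]] gu; split; first by rewrite jet0 -gu.
exists g', (jet_path (fun k : 'I_n.+1 => u k.+1)); split=> //.
- by near=> t; exact: is_derive_jet_path.
- apply: (IH g' (fun k => u k.+1)) => // k kn.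
  by rewrite -(gu k.+1)// (nbhs_singleton (near_derive1nS k gD)).
Unshelve. all: by end_near. Qed.

(** * Taylor's theorem with Peano remainder *)

Lemma MVT_at0 (R : realType) (g g' : R -> R) (t : R) :
  (forall s, `|s| <= `|t| -> is_derive s (1 : R) g (g' s)) ->
  exists2 c, `|c| <= `|t| & g t - g 0 = g' c * t.
Proof.
move=> gD.
have gc (a b : R) : (forall s, s \in `[a, b] -> `|s| <= `|t|) ->
    {within `[a, b], continuous g}.
  move=> ab; apply: derivable_within_continuous => s /ab/gD.
  by case.
have [t0|t0] := leP 0 t.
  have sub s : s \in `[0, t] -> `|s| <= `|t|.
    by rewrite in_itv/= => /andP[s0 st]; rewrite !ger0_norm.
  have [|c /sub ct e] := @MVT_segment _ g g' _ _ t0 _ (gc _ _ sub).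
    by move=> s /subset_itv_oo_cc/sub/gD.
  by exists c => //; rewrite e subr0.
have sub s : s \in `[t, 0] -> `|s| <= `|t|.
  by rewrite in_itv/= => /andP[st s0]; rewrite !ler0_norm ?lerN2// ltW.
have [|c /sub ct e] := @MVT_segment _ g g' _ _ (ltW t0) _ (gc _ _ sub).
  by move=> s /subset_itv_oo_cc/sub/gD.
by exists c => //; rewrite -opprB e sub0r mulrN opprK.
Qed.

(** At order 1 this is the definition of the derivative at 0.  Then a bound
    e * |s|^(n+1) on the derivative of [g - h] gives, by the mean value theorem
    between 0 and t in each coordinate, the bound e * |t|^(n+2) on [g - h],
    the norm being the maximum of the coordinates. *)
Lemma eq_jet_littleo (R : realType) (d n : nat) (g h : R -> 'rV[R]_d) :
  eq_jet n.+1 g h ->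
  forall e : R, 0 < e ->
    \forall t \near (0 : R), `|g t - h t| <= e * `|t| ^+ n.+1.
Proof.
elim: n g h => [|n IH] g h [gh0 [g' [h' [gD hD gh]]]] e e0.
  have ghD := is_deriveB (nbhs_singleton gD) (nbhs_singleton hD).
  have [gh' gh'0] := ghD.
  have /eqaddoP/(_ _ e0) := iffLR (derivable_nbhsP _ _ _) gh'.
  apply: filterS => t /=.
  rewrite -![(_ + _ : _ -> _) _]/(_ + _) -![(- _ : _ -> _) _]/(- _) /=.
  rewrite gh'0 (proj1 gh) gh0.
  rewrite -[X in _ - X]/(h 0 - h 0 + t *: (h' 0 - h' 0)).
  by rewrite !subrr scaler0 !addr0 subr0 [_ *: 1]mulr1 expr1.
have /nbhs_ballP[del /= del0 D] :
    \forall s \near (0 : R), is_derive s (1 : R) (g \- h) (g' s - h' s) /\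
      `|g' s - h' s| <= e * `|s| ^+ n.+1.
  near=> s; split; last by near: s; exact: IH.
  by apply: is_deriveB; near: s.
apply/nbhs_ballP; exists del => //= t.
rewrite -ball_normE/= sub0r normrN => td.
have {}D s : `|s| <= `|t| -> is_derive s (1 : R) (g \- h) (g' s - h' s) /\
      `|g' s - h' s| <= e * `|s| ^+ n.+1.
  by move=> st; apply: D; rewrite -ball_normE/= sub0r normrN (le_lt_trans st).
have et : 0 <= e * `|t| ^+ n.+2 by rewrite mulr_ge0 ?exprn_ge0// ltW.
rewrite [leLHS]/Num.norm/= mx_normrE; apply/bigmax_leP; split=> //= -[i j] _ /=.
have [|c ct] := @MVT_at0 R (fun s => (g s - h s) i j)
    (fun s => (g' s - h' s) i j) t.
  by move=> s /D[/is_derive_mx].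
rewrite gh0 subrr [X in _ - X]mxE subr0 => ->.
rewrite normrM exprSr mulrA ler_wpM2r//.
have [_ Dc] := D _ ct; apply: (@le_trans _ _ `|g' c - h' c|).
  rewrite [leRHS]/Num.norm/= mx_normrE.
  exact: (le_bigmax _ (fun ij => `|(g' c - h' c) ij.1 ij.2|) (i, j)).
apply: le_trans Dc _; apply: ler_wpM2l; first exact: ltW.
by rewrite lerXn2r ?nnegrE.
Unshelve. all: by end_near. Qed.

Theorem mainTheorem3 (R : realType) (d N : nat) (hN : (1 <= N)%N)
  (z : 'rV[R]_d) (f : 'rV[R]_d -> 'rV[R]_d)
  (T : set R) (w : R -> 'rV[R]_d)
  (hf : Ck_near N.-1 z f)
  (hTopen : open T) (hTitv : is_interval T) (hT0 : T 0)
  (hw : exists U : set R,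
          [/\ open_nbhs 0 U, U `<=` T & Ck_path_on N.-1 U w])
  (hLip : N = 1%N -> locally_lipschitz f)
  (x0 : nat -> 'rV[R]_d)
  (hx0_0 : x0 0%N = z)
  (hx0_S : forall n : nat, (n <= N.-1)%N ->
     x0 n.+1 = gen_flow f (fun k : 'I_n.+1 => x0 k) + derive1n n w 0)
  (x : R -> 'rV[R]_d)
  (hx_ode : \forall t \near (0 : R), is_derive t (1 : R) x (f (x t) + w t))
  (hx_init : x 0 = z) :
  exists e : R, 0 < e /\
    (forall (n : nat) (t : R), (n < N)%N -> - e < t < e ->
       derivable (derive1n n x) t 1) /\
    exists r : R -> 'rV[R]_d,
      r =o_ (0 : R) (fun t : R => `|t| ^+ N) /\
      forall t : R, - e < t < e ->
        \sum_(n < N.+1) (t ^+ n / n`!%:R) *: x0 n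
          = \sum_(n < N.+1) (t ^+ n / n`!%:R) *: derive1n n x 0
        /\ \sum_(n < N.+1) (t ^+ n / n`!%:R) *: derive1n n x 0
          = x t + r t.
Proof.
have [U [Uf0 UT [wD _]]] := hw.
have [M MN] : exists M, N = M.+1 by exists N.-1; rewrite prednK.
subst N; rewrite /= in hf hw hx0_S wD.
have ww n : (n <= M)%N -> eq_jet n w w.
  move=> nM; apply: derivable_eq_jet.
  apply: filterS (open_nbhs_nbhs Uf0) => t Ut k kn; apply: wD => //.
  exact: leq_trans nM.
(* The value of the n-th derivative is carried along: it provides the lower
   coefficients in the next step. *)
have xj n : (n <= M.+1)%N -> eq_jet n x (jet_path (fun k : 'I_n.+1 => x0 k)) /\
    derive1n n x 0 = x0 n.
  elim/ltn_ind: n => -[|n] IH nM.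
    by split; [apply: eq_jet_jet_path => // -[|//] _|]; rewrite /= hx_init.
  have fj k : (k <= n)%N -> eq_jet k (fun t => f (x t))
      (fun t => f (jet_path (fun i : 'I_k.+1 => x0 i) t)).
    move=> kn; apply: eq_jet_comp; last by apply: (IH k _ _).1; lia.
    rewrite hx_init; have [V [Vz fC]] := hf; exists V; split=> //.
    by apply: Ck_on_le fC; lia.
  have xx : eq_jet n.+1 x x.
    split=> //; exists (fun t => f (x t) + w t), (fun t => f (x t) + w t).
    split=> //; apply: eq_jetD; last exact: ww.
    exact: eq_jetl (fj n (leqnn n)).
  (* gen_flow at order n is the n-th derivative of f along the Taylor
     polynomial of order n, with which x agrees to that order. *)
  have xn : derive1n n.+1 x 0 = x0 n.+1.
    rewrite (nbhs_singleton (near_derive1nS n hx_ode)) hx0_S//.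
    rewrite derive1nD; [|exact: eq_jetl (fj n (leqnn n))|exact: ww].
    by rewrite (eq_jet_derive1n (fj n (leqnn n))).
  split=> //; apply: eq_jet_jet_path => // k.
  by rewrite leq_eqVlt => /predU1P[->//|kn]; apply: (IH k _ _).2; lia.
have [xN _] := xj _ (leqnn M.+1).
have /nbhs_ballP[e /= e0 xd] := eq_jet_derivable xN.
exists e; split=> //; split.
  move=> n t nM te; apply: xd => //.
  by rewrite -ball_normE/= sub0r normrN ltr_norml.
exists (fun t => \sum_(n < M.+2) (t ^+ n / n`!%:R) *: derive1n n x 0 - x t).
have x0E t : \sum_(n < M.+2) (t ^+ n / n`!%:R) *: x0 n =
    \sum_(n < M.+2) (t ^+ n / n`!%:R) *: derive1n n x 0.
  by apply: eq_bigr => i _; rewrite (xj i _).2// -ltnS.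
split; last by move=> t _; split; [exact: x0E|rewrite addrC subrK].
apply/eqoP => eps eps0; apply: filterS (eq_jet_littleo xN eps0) => t rt.
rewrite [X in _ <= _ * X]ger0_norm ?exprn_ge0//.
by rewrite -x0E distrC.
Qed.
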